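(* For every integer $n>1$: (i) $$K_{\leq}(n)=d_{3,1}(n)-d_{3,2}(n)+2\sum_{m=1}^{\lfloor\frac{-1+\sqrt{1+24n}}{6}\rfloor}m(-1)^{m-1}\,p(n-P_{-m}).$$ (ii) $$K_{\leq}(n)\equiv d_{3,1}(n)-d_{3,2}(n)\pmod 2.$$
   Context: For a partition $\pi$ of a positive integer $n$, the Kimberling index is $K(\pi)=(\text{largest part of }\pi)-(\text{least part of }\pi)-(\text{number of parts of }\pi)$. $K_{\leq}(n)$ is the number of partitions $\pi$ of $n$ with $K(\pi)\le 0$. $p(n)$ is the number of partitions of $n$, with $p(0)=1$. $d_{3,j}(n)$ is the number of positive divisors $d$ of $n$ with $d\equiv j\pmod 3$. For $m\in\mathbb{Z}$, $P_m=\frac{m(3m-1)}{2}$, so $P_{-m}=\frac{m(3m+1)}{2}$. *)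

(* Defs.v *)
From mathcomp Require Import all_boot all_order all_algebra.
From mathcomp Require Import reals.

Set Implicit Arguments.
Unset Strict Implicit.
Unset Printing Implicit Defensive.

Import Order.TTheory GRing.Theory Num.Theory.

Local Open Scope nat_scope.

(* Parts are listed in weakly decreasing order, so the head is the largest
   part and the last element the least one. *)
Definition is_partition (n : nat) (s : seq nat) : bool :=
  [&& sorted geq s, all (leq 1) s & sumn s == n].

(* A partition of n has at most n parts, all of them at most n; partitions of n
   are therefore counted inside the finite type n.-bseq 'I_n.+1, which contains
   every one of them by partitions_onto below. *)
Definition partitions (n : nat) : {set n.-bseq 'I_n.+1} :=
  [set t : n.-bseq 'I_n.+1 | is_partition n (map val t)].

Lemma partitions_onto (n : nat) (s : seq nat) :
  is_partition n s ->
  exists2 t : n.-bseq 'I_n.+1, t \in partitions n & map val t = s.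
Proof.
move=> ps; have /and3P[_ s_gt0 /eqP sum_s] := ps.
have size_s : size s <= n.
  rewrite -sum_s; elim: s s_gt0 {ps sum_s} => //= x s IHs /andP[x_gt0 /IHs].
  by rewrite -add1n; apply: leq_add.
have le_s : all (fun x => x < n.+1) s.
  rewrite -sum_s; apply/allP => x xs; rewrite ltnS sumnE (big_rem x) //=.
  exact: leq_addr.
have val_s : map val (map (@inord n) s) = s.
  rewrite -map_comp -[RHS]map_id; apply/eq_in_map => x xs /=.
  by rewrite inordK // (allP le_s).
have size_t : size (map (@inord n) s) <= n by rewrite size_map.
by exists (Bseq size_t); rewrite ?inE /= val_s.
Qed.

Definition npartitions (n : nat) : nat := #|partitions n|.

(* Integer argument, because n - P_{-m} is an integer subtraction; a negative
   integer has no partition. *)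
Definition p (k : int) : nat := if k is Posz n then npartitions n else 0.

Definition kimberling (s : seq nat) : int :=
  ((head 0 s)%:Z - (last 0 s)%:Z - (size s)%:Z)%R.

Definition K_le (n : nat) : nat :=
  #|[set t in partitions n | (kimberling (map val t) <= 0)%R]|.

Definition d3 (j n : nat) : nat :=
  count (fun d => d == j %[mod 3]) (divisors n).

(* The division is exact, m (3m - 1) being even. *)
Definition P (m : int) : int := ((m * (3 * m - 1))%R %/ 2)%Z.

(* Main.v *)
(* Fixing the least part s and the number k + 1 of parts, the partitions with
   Kimberling index at most 0 are generated by q^(s(k+1)) [2k+1 choose k]_q. The
   sums D_s(r) = sum_k q^(sk) [2k+r choose k]_q satisfy two recurrences coming
   from the two Pascal rules; together they make D_1(r) + q^(r+3) D_1(r+3)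
   independent of r, hence equal to the generating function of all partitions
   (letting r grow), which is Dyson's argument for the rank. Iterating expands
   D_1, hence every D_s, as a sum over m, and summing q^s D_s(1) over s with the
   Rogers-Fine identity gives
     sum_n K_le(n) q^n
       = 1/(q)_oo sum_(m >= 1) (-1)^(m-1) m (q^(P_m) + q^(P_(-m))).
   The logarithmic derivative at z = 1 of the Jacobi triple product in base q^3
   gives
     sum_n (d_(3,1)(n) - d_(3,2)(n)) q^n
       = 1/(q)_oo sum_(m >= 1) (-1)^(m-1) m (q^(P_m) - q^(P_(-m))),
   and the theorem is the difference of the two identities. *)
Require Import Defs.
From mathcomp Require Import all_boot all_order all_algebra.
From mathcomp Require Import reals.
From mathcomp Require Import zify ring lra.

Set Implicit Arguments.
Unset Strict Implicit.
Unset Printing Implicit Defensive.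

Import Order.TTheory GRing.Theory Num.Theory.

Local Open Scope ring_scope.

(** * Gaussian binomials and the Kimberling series *)

(* [gauss q a b] is the Gaussian binomial coefficient [a + b choose a]_q. *)
Fixpoint gauss (A : comNzRingType) (q : A) (a b : nat) {struct a} : A :=
  if a is a'.+1 then
    (fix gauss_row (b : nat) : A :=
       if b is b'.+1 then q ^+ b * gauss q a' b + gauss_row b' else 1) b
  else 1.

Arguments gauss : simpl never.

Section Gauss.
Context (A : comNzRingType) (q : A).

Lemma gauss0n b : gauss q 0 b = 1. Proof. by []. Qed.

Lemma gaussn0 a : gauss q a 0 = 1. Proof. by case: a. Qed.

Lemma gaussSS a b :
  gauss q a.+1 b.+1 = q ^+ b.+1 * gauss q a b.+1 + gauss q a.+1 b.
Proof. by []. Qed.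

(** The second Pascal rule, by induction on [a + b]: expanding the left side by the first rule and
    then by induction, and the right side by the first rule, gives the same four terms. *)
Lemma gaussSS_dual a b :
  gauss q a.+1 b.+1 = gauss q a b.+1 + q ^+ a.+1 * gauss q a.+1 b.
Proof.
have [m] := ubnP (a + b); elim: m a b => // m IHm [|a] [|b] lt_m.
- by rewrite gaussSS !gauss0n gaussn0; ring.
- rewrite gaussSS {1}IHm; last by lia.
  by rewrite [gauss q 1 b.+1]gaussSS !gauss0n !exprS; ring.
- rewrite gaussSS {1}IHm; last by lia.
  by rewrite [gauss q a.+1 1]gaussSS !gaussn0 !exprS; ring.
- have H1 : gauss q a.+1 b.+2 = _ := IHm a b.+1 ltac:(lia).
  have H2 : gauss q a.+2 b.+1 = _ := IHm a.+1 b ltac:(lia).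
  rewrite [LHS]gaussSS {1}H1 {1}H2 [in RHS](gaussSS a b.+1) [in RHS](gaussSS a.+1 b).
  by rewrite !exprS; ring.
Qed.

End Gauss.

Definition qpoch (A : comNzRingType) (q x : A) (n : nat) : A :=
  \prod_(i < n) (1 - x * q ^+ i).

Lemma qpoch0 (A : comNzRingType) (q x : A) : qpoch q x 0 = 1.
Proof. exact: big_ord0. Qed.

Lemma qpochSr (A : comNzRingType) (q x : A) n :
  qpoch q x n.+1 = qpoch q x n * (1 - x * q ^+ n).
Proof. exact: big_ord_recr. Qed.

Lemma qpochSl (A : comNzRingType) (q x : A) n :
  qpoch q x n.+1 = (1 - x) * qpoch q (x * q) n.
Proof.
rewrite /qpoch big_ord_recl expr0 mulr1; congr (_ * _).
by apply: eq_bigr => i _; rewrite -mulrA -exprS.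
Qed.

(* The pentagonal numbers P_m and P_{-m}. *)
Definition pen1 (m : nat) : nat := (3 * 'C(m, 2) + m)%N.
Definition pen2 (m : nat) : nat := (3 * 'C(m, 2) + 2 * m)%N.

Lemma bin2S m : ('C(m.+1, 2) = 'C(m, 2) + m)%N.
Proof. by rewrite binS bin1. Qed.

Lemma bin2D m n : ('C(m + n, 2) = 'C(m, 2) + 'C(n, 2) + m * n)%N.
Proof. by elim: n => [|n IHn]; rewrite ?addn0 ?muln0 ?addn0 // addnS !bin2S; lia. Qed.

(** The diagonal [M = m + n] holds [M.+1] pairs, which is the source of the factor m in the
    Kimberling series. *)
Lemma sum_diag (A : nmodType) (h : nat -> A) N :
  (forall M, (N <= M)%N -> h M = 0) ->
  \sum_(m < N) \sum_(n < N) h (m + n)%N = \sum_(M < N) h M *+ M.+1.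
Proof.
move=> h0; rewrite -(big_mkord xpredT (fun m => \sum_(n < N) h (m + n)%N)).
transitivity (\sum_(0 <= m < N) \sum_(0 <= M < N | (m <= M)%N) h M).
  apply: eq_big_nat => m /andP[_ lt_mN].
  rewrite -(big_mkord xpredT (fun n => h (m + n)%N)).
  rewrite -(@big_nat_widenl _ _ _ m 0 N xpredT h) //.
  have -> : \sum_(m <= M < N) h M = \sum_(m <= M < N + m) h M.
    rewrite [RHS](@big_cat_nat _ _ _ N) ?leq_addr 1?ltnW //=.
    by rewrite [X in _ + X]big_nat [X in _ + X]big1 ?addr0 // => M /andP[/h0].
  rewrite -{2}[m]add0n big_addn addnK.
  by apply: eq_bigr => n _; rewrite addnC.
rewrite (exchange_big_dep_nat xpredT) //= big_mkord; apply: eq_bigr => M _.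
rewrite -(@big_nat_widen _ _ _ 0 M.+1 N xpredT (fun=> h M)) //.
by rewrite big_const_nat iter_addr_0 subn0.
Qed.

Lemma sum_shift (A : nmodType) (N : nat) (F : nat -> A) :
  F N = 0 -> \sum_(k < N) F k = F 0 + \sum_(k < N) F k.+1.
Proof.
move=> FN; rewrite -(big_ord_recl N (fun k : 'I_N.+1 => F k)).
by rewrite big_ord_recr /= FN addr0.
Qed.

(* Working modulo q^N turns every infinite sum into a finite one. *)
Section Truncated.
Context (A : comNzRingType) (q : A) (N : nat).
Context (qN : q ^+ N = 0).

Lemma expq_eq0 k : (N <= k)%N -> q ^+ k = 0.
Proof. by move=> /subnKC <-; rewrite exprD qN mul0r. Qed.

Lemma gauss_stablel a b : (N <= a)%N -> gauss q a b = gauss q N b.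
Proof.
move=> /subnKC <-; elim: (_ - _)%N => [|k IHk]; first by rewrite addn0.
case: b IHk => [|b] IHk; first by rewrite !gaussn0.
by rewrite addnS gaussSS_dual expq_eq0 ?mul0r ?addr0 ?IHk // leqW ?leq_addr.
Qed.

Lemma gauss_stabler a b : (N <= b)%N -> gauss q a b = gauss q a N.
Proof.
move=> /subnKC <-; elim: (_ - _)%N => [|k IHk]; first by rewrite addn0.
case: a IHk => [|a] IHk; first by rewrite !gauss0n.
by rewrite addnS gaussSS expq_eq0 ?mul0r ?add0r ?IHk // leqW ?leq_addr.
Qed.

(** Modulo q^N this is 1/(q)_oo, since Gaussian binomials are stable once both indices reach [N]. *)
Definition pser : A := gauss q N N.

Lemma gauss_pser a b : (N <= a)%N -> (N <= b)%N -> gauss q a b = pser.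
Proof. by move=> leNa leNb; rewrite gauss_stablel // gauss_stabler. Qed.

Lemma gauss_qpoch b : gauss q N b * qpoch q q b = 1.
Proof.
elim: b => [|b IHb]; first by rewrite gaussn0 qpoch0 mulr1.
rewrite qpochSr -exprS -[RHS]IHb.
have -> : gauss q N b = gauss q N b.+1 * (1 - q ^+ b.+1); last by ring.
have := gaussSS q N b; rewrite !gauss_stablel // => E.
by rewrite mulrBr mulr1 {1}E; ring.
Qed.

Lemma pser_qpoch b : (N <= b)%N -> pser * qpoch q q b = 1.
Proof. by move=> leNb; rewrite /pser -(gauss_stabler N leNb) gauss_qpoch. Qed.

(** The sum D_s(r), as [gauss q k (k + r)] is [2k+r choose k]_q. For s > 0 the terms cut off are
    zero. *)
Definition dsum (s r : nat) : A :=
  \sum_(k < N) q ^+ (s * k) * gauss q k (k + r).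

(** Apply the first Pascal rule to every term k > 0; the terms k = 0 agree. The next recurrence
    comes from the second rule in the same way. *)
Lemma dsumSl s r : (0 < s)%N ->
  dsum s r.+1 = dsum s r + q ^+ (s + r + 2) * dsum s.+1 r.+2.
Proof.
move=> s_gt0; have sN a : q ^+ (s * N) * a = 0.
  by rewrite expq_eq0 ?mul0r // leq_pmull.
rewrite /dsum (@sum_shift _ _ (fun k => q ^+ (s * k) * gauss q k (k + r.+1))) //.
rewrite [in RHS](@sum_shift _ _ (fun k => q ^+ (s * k) * gauss q k (k + r))) //.
rewrite !muln0 !gauss0n -addrA mulr_sumr -big_split /=; congr (_ + _).
apply: eq_bigr => k _; rewrite !(addSn, addnS) gaussSS mulrDr !(mulnS, mulSn).
by rewrite !addn0 !(exprS, exprD); ring.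
Qed.

Lemma dsumSr s r : (0 < s)%N ->
  dsum s r.+1 = q ^+ s * dsum s r.+2 + dsum s.+1 r.
Proof.
move=> s_gt0; have sN a : q ^+ (s * N) * a = 0.
  by rewrite expq_eq0 ?mul0r // leq_pmull.
have tN a : q ^+ (s.+1 * N) * a = 0.
  by rewrite expq_eq0 ?mul0r // leq_pmull.
rewrite /dsum (@sum_shift _ _ (fun k => q ^+ (s * k) * gauss q k (k + r.+1))) //.
rewrite [in RHS](@sum_shift _ _ (fun k => q ^+ (s.+1 * k) * gauss q k (k + r))) //.
rewrite !muln0 !gauss0n addrCA mulr_sumr -big_split /=; congr (_ + _).
apply: eq_bigr => k _; rewrite !(addSn, addnS) gaussSS_dual !(mulnS, mulSn).
by rewrite !(exprS, exprD); ring.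
Qed.

(** For large r the summand is q^k/(q)_k, and the partial sum up to K telescopes to 1/(q)_K. *)
Lemma dsum_large r : (N <= r)%N -> dsum 1 r = pser.
Proof.
move=> leNr; have E K : \sum_(k < K.+1) q ^+ k * gauss q k N = gauss q K N.
  elim: K => [|K IHK]; first by rewrite big_ord1 mul1r.
  rewrite big_ord_recr IHK -[RHS](gauss_stabler _ (leqnSn N)) gaussSS_dual.
  by rewrite gauss_stabler.
rewrite /pser -E big_ord_recr /= qN mul0r addr0; apply: eq_bigr => k _.
by rewrite mul1n gauss_stabler // (leq_trans leNr) ?leq_addl.
Qed.

(** Passing from r to r+1 changes nothing: [dsumSl] on D_1(r+1) and [dsumSr] on D_1(r+3) both
    produce q^(r+3) D_2(r+2), which cancels. After N shifts only [dsum_large] remains. *)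
Lemma dsum_step r : dsum 1 r + q ^+ (r + 3) * dsum 1 r.+3 = pser.
Proof.
have E k : dsum 1 r + q ^+ (r + 3) * dsum 1 r.+3 =
    dsum 1 (r + k) + q ^+ (r + k + 3) * dsum 1 (r + k).+3.
  elim: k => [|k ->]; first by rewrite addn0.
  rewrite !addnS !addn0 [dsum 1 (r + k).+1]dsumSl // [dsum 1 (r + k).+3]dsumSr //.
  by rewrite !(add1n, addnS, addSn, addn0, exprS); ring.
rewrite (E N) expq_eq0 ?mul0r ?addr0 ?dsum_large ?leq_addl //.
by rewrite addnAC leq_addl.
Qed.

Lemma dsum1E r :
  dsum 1 r = pser * \sum_(m < N) (-1) ^+ m * q ^+ (3 * 'C(m.+1, 2) + m * r).
Proof.
(* Unfolding [dsum_step] K times leaves a remainder whose power of q vanishes at K = N. *)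
have E K : dsum 1 r =
    pser * (\sum_(m < K) (-1) ^+ m * q ^+ (3 * 'C(m.+1, 2) + m * r))
    + (-1) ^+ K * q ^+ (3 * 'C(K.+1, 2) + K * r) * dsum 1 (r + 3 * K).
  elim: K => [|K ->].
    by rewrite big_ord0 bin2S bin0n !mul0n addn0 mulr0 add0r !mul1r muln0 addn0.
  rewrite big_ord_recr /= [in RHS]mulrDr -addrA; congr (_ + _).
  rewrite -(dsum_step (r + 3 * K)) [in RHS](bin2S K.+1).
  have -> : (r + 3 * K.+1 = (r + 3 * K).+3)%N by lia.
  have -> : (3 * ('C(K.+1, 2) + K.+1) + K.+1 * r =
             3 * 'C(K.+1, 2) + K * r + (r + 3 * K + 3))%N by lia.
  by rewrite exprS !exprD; ring.
rewrite (E N) expq_eq0 ?mulr0 ?mul0r ?addr0 // bin2S.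
by rewrite mulnDr -addnA addnCA -{1}[N]mul1n; lia.
Qed.

(** Induction on s: solving [dsumSr] for the larger s multiplies the m-th term by 1 - q^(m+1+s), the
    next factor of the q-Pochhammer symbol. *)
Lemma dsumE s r : dsum s.+1 r =
  pser * \sum_(m < N) (-1) ^+ m * q ^+ (3 * 'C(m.+1, 2) + m * (r + s)) *
                      qpoch q (q ^+ m.+1) s.
Proof.
elim: s r => [|s IHs] r.
  by rewrite dsum1E; congr (_ * _); apply: eq_bigr => m _; rewrite qpoch0 mulr1 addn0.
have -> : dsum s.+2 r = dsum s.+1 r.+1 - q ^+ s.+1 * dsum s.+1 r.+2.
  by rewrite [dsum s.+1 r.+1]dsumSr //; ring.
rewrite !IHs mulrCA -mulrBr mulr_sumr -sumrB; congr (_ * _).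
apply: eq_bigr => m _; rewrite qpochSr.
have -> : (3 * 'C(m.+1, 2) + m * (r.+2 + s) =
             3 * 'C(m.+1, 2) + m * (r + s.+1) + m)%N by lia.
rewrite addSnnS !exprD !exprS; ring.
Qed.

Definition rfine (x : A) : A := \sum_(s < N) x ^+ s.+1 * qpoch q x s.

(** Past its first term the sum carries the factor (1 - x)x^2. Then (1 - x) x^s (xq)_s is a
    difference of consecutive values of x^s (xq)_s minus x times a term of [rfine (x * q)], so the
    differences telescope. *)
Lemma rfine_step x :
  x ^+ N = 0 -> rfine x = x + x ^+ 2 - x ^+ 3 * rfine (x * q).
Proof.
move=> xN; rewrite /rfine.
rewrite (@sum_shift _ _ (fun s => x ^+ s.+1 * qpoch q x s)); last first.
  by rewrite exprS xN mulr0 mul0r.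
rewrite expr1 qpoch0 mulr1 -addrA; congr (_ + _).
have E K : (1 - x) * \sum_(s < K) x ^+ s * qpoch q (x * q) s =
    1 - x ^+ K * qpoch q (x * q) K
      - x * \sum_(s < K) (x * q) ^+ s.+1 * qpoch q (x * q) s.
  elim: K => [|K IHK]; first by rewrite !big_ord0 qpoch0; ring.
  rewrite !big_ord_recr /= !mulrDr IHK qpochSr !exprMn !exprS; ring.
transitivity (x ^+ 2 * ((1 - x) * \sum_(s < N) x ^+ s * qpoch q (x * q) s)).
  rewrite !mulr_sumr; apply: eq_bigr => s _.
  by rewrite qpochSl !exprS; ring.
by rewrite E xN; ring.
Qed.

(* The Rogers-Fine identity, by iterating [rfine_step]. *)
Lemma rfineE m : rfine (q ^+ m.+1) =
  \sum_(n < N) (-1) ^+ n * q ^+ (m.+1 * (3 * n + 1) + pen1 n) *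
               (1 + q ^+ (m.+1 + n)).
Proof.
have E K : rfine (q ^+ m.+1) =
    \sum_(n < K) (-1) ^+ n * q ^+ (m.+1 * (3 * n + 1) + pen1 n) *
                 (1 + q ^+ (m.+1 + n)) +
    (-1) ^+ K * q ^+ (m.+1 * (3 * K) + 3 * 'C(K, 2)) * rfine (q ^+ (m.+1 + K)).
  elim: K => [|K ->].
    by rewrite big_ord0 !muln0 !addn0 add0r !mul1r.
  rewrite big_ord_recr /= -addrA; congr (_ + _).
  rewrite rfine_step; last by rewrite -exprM expq_eq0 ?leq_pmull.
  rewrite -exprSr -addnS.
  have -> : (m.+1 * (3 * K.+1) + 3 * 'C(K.+1, 2) =
             m.+1 * (3 * K) + 3 * 'C(K, 2) + 3 * (m.+1 + K))%N.
    by rewrite bin2S; lia.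
  have -> : (m.+1 * (3 * K + 1) + pen1 K =
             m.+1 * (3 * K) + 3 * 'C(K, 2) + (m.+1 + K))%N.
    by rewrite /pen1; lia.
  move: (m.+1 * (3 * K) + 3 * 'C(K, 2))%N (rfine _) => e f.
  by rewrite [(3 * _)%N]mulnC !(exprD q e) exprM (exprS (-1)); ring.
rewrite (E N) expq_eq0 ?mulr0 ?mul0r ?addr0 //.
by rewrite (leq_trans _ (leq_addr _ _)) // mulnA leq_pmull.
Qed.

(* The left-hand side generates the partitions with Kimberling index at most 0,
   its summand [s] those with least part [s.+1]. *)
Lemma kimberling_ser :
  \sum_(s < N) q ^+ s.+1 * dsum s.+1 1 =
  pser * \sum_(M < N) (-1) ^+ M * (q ^+ pen1 M.+1 + q ^+ pen2 M.+1) *+ M.+1.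
Proof.
under eq_bigr => s _ do rewrite dsumE mulrCA mulr_sumr.
rewrite -mulr_sumr exchange_big /=; congr (_ * _).
pose h M := (-1) ^+ M * (q ^+ pen1 M.+1 + q ^+ pen2 M.+1).
rewrite -(@sum_diag _ h N) /h => [|M leNM]; last first.
  by rewrite !expq_eq0 ?addr0 ?mulr0 // /pen1 /pen2; lia.
apply: eq_bigr => m _.
(* For fixed m the exponents depending on s add up to (m+1)(s+1), so the sum over least parts is a
   Rogers-Fine sum at q^(m+1). *)
transitivity ((-1) ^+ m * q ^+ (3 * 'C(m.+1, 2)) * rfine (q ^+ m.+1)).
  rewrite /rfine mulr_sumr; apply: eq_bigr => s _.
  have -> : (3 * 'C(m.+1, 2) + m * (1 + s) =
             3 * 'C(m.+1, 2) + m * s.+1)%N by lia.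
  rewrite -exprM [(m.+1 * _)%N]mulSn !exprD; ring.
rewrite rfineE mulr_sumr; apply: eq_bigr => n _.
have -> : pen1 (m + n).+1 =
    (3 * 'C(m.+1, 2) + (m.+1 * (3 * n + 1) + pen1 n))%N.
  rewrite /pen1 -addSn bin2D; lia.
have -> : pen2 (m + n).+1 =
    (3 * 'C(m.+1, 2) + (m.+1 * (3 * n + 1) + pen1 n) + (m.+1 + n))%N.
  rewrite /pen1 /pen2 -addSn bin2D; lia.
rewrite !exprD; ring.
Qed.

End Truncated.

(** * The derivative of the triple product *)

(* [penz d] is P_{-d} for every integer [d]. *)
Definition penz (d : int) : nat :=
  match d with Posz m => pen2 m | Negz m => pen1 m.+1 end.

Lemma penzS d : (penz (d + 1))%:Z = (penz d)%:Z + 3 * d + 2.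
Proof.
case: d => [m|[|m]].
- by rewrite -PoszD addn1 /= /pen2 bin2S; lia.
- by [].
- have -> : Negz m.+1 + 1 = Negz m by lia.
  by rewrite /= /pen1 (bin2S m.+1); lia.
Qed.

Lemma penz_geq d : (`|d| <= penz d)%N.
Proof. by case: d => m; rewrite /= /pen1 /pen2; lia. Qed.

Section TripleProduct.
Context (A : comNzRingType) (q : A).

(** The binomial [n choose k] in base q^3, extended by zero so that both Pascal rules also hold at k
    = n. *)
Definition qbin (n k : nat) : A :=
  if (k <= n)%N then gauss (q ^+ 3) k (n - k) else 0.

Lemma qbin_small n k : (n < k)%N -> qbin n k = 0.
Proof. by rewrite /qbin; case: leqP. Qed.

Lemma qbinn0 n : qbin n 0 = 1.
Proof. by []. Qed.

Lemma qbinSS n k : (k <= n)%N ->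
  qbin n.+1 k.+1 = qbin n k.+1 + q ^+ (3 * (n - k)) * qbin n k.
Proof.
move=> le_kn; rewrite /qbin ltnS le_kn subSS; case: ltngtP le_kn => // [lt_kn|->] _.
  by rewrite -(subnSK lt_kn) gaussSS exprM addrC.
by rewrite subnn !gaussn0 mulr1 add0r.
Qed.

Lemma qbinSS_dual n k : (k <= n)%N ->
  qbin n.+1 k.+1 = qbin n k + q ^+ (3 * k.+1) * qbin n k.+1.
Proof.
move=> le_kn; rewrite /qbin ltnS le_kn subSS; case: ltngtP le_kn => // [lt_kn|->] _.
  by rewrite -(subnSK lt_kn) gaussSS_dual exprM.
by rewrite subnn !gaussn0 mulr0 addr0.
Qed.

(* The coefficient of z^k in
   prod_(i < a) (z - q^(3i+1)) * prod_(j < b) (1 - z q^(3j+2)). *)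
Definition tcoef (a b k : nat) : A :=
  (-1) ^+ (a + k) * q ^+ penz (k%:Z - a%:Z) * qbin (a + b) k.

(* The weight [w] is constant to evaluate the product at z = 1, and the identity
   to evaluate its logarithmic derivative there. *)
Definition tsum (a b : nat) (w : int -> A) : A :=
  \sum_(k < (a + b).+1) w (k%:Z - a%:Z) * tcoef a b k.

(** With d = k - a as exponent of z, the product is that of the factors 1 - q^(3i+1)/z and 1 - z
    q^(3j+2), and z^d is evaluated to [w d]. A new factor 1 - z q^(3b+2) can thus be moved into the
    weight. *)
Lemma tsumSr a b w :
  tsum a b.+1 w = tsum a b (fun d => w d - q ^+ (3 * b + 2) * w (d + 1)).
Proof.
rewrite /tsum; under [RHS]eq_bigr => k _ do rewrite mulrBl.
rewrite sumrB [X in _ = X - _](@sum_shift _ _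
  (fun k => w (k%:Z - a%:Z) * tcoef a b k)); last first.
  by rewrite /tcoef qbin_small ?mulr0.
rewrite -addrA -sumrB addnS big_ord_recl /tcoef !qbinn0; congr (_ + _).
apply: eq_bigr => k _; rewrite lift0 (addnS a b) qbinSS ?(leq_ord k) //.
have -> : k.+1%:Z - a%:Z = k%:Z - a%:Z + 1 by lia.
have E : (3 * b + 2 + penz (k%:Z - a%:Z) =
          penz (k%:Z - a%:Z + 1) + 3 * (a + b - k))%N.
  have := penzS (k%:Z - a%:Z); have := ltn_ord k; move: (penz _) (penz _) => u v. lia.
transitivity (w (k%:Z - a%:Z + 1) * ((-1) ^+ (a + k).+1) *
  (q ^+ penz (k%:Z - a%:Z + 1) * qbin (a + b) k.+1
   + q ^+ (3 * b + 2 + penz (k%:Z - a%:Z)) * qbin (a + b) k)).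
  by rewrite E addnS (exprD _ (penz _)); ring.
by rewrite (addnS a) (exprD _ (3 * b + 2)%N) (exprS (-1)); ring.
Qed.

(** The same for a new factor 1 - q^(3a+1)/z, now with the dual Pascal rule. *)
Lemma tsumSl a b w :
  tsum a.+1 b w = tsum a b (fun d => w d - q ^+ (3 * a + 1) * w (d - 1)).
Proof.
rewrite /tsum; under [RHS]eq_bigr => k _ do rewrite mulrBl.
rewrite sumrB [X in _ = _ - X](@sum_shift _ _
  (fun k => q ^+ (3 * a + 1) * w (k%:Z - a%:Z - 1) * tcoef a b k)); last first.
  by rewrite /tcoef qbin_small ?mulr0.
rewrite opprD addrCA -sumrB addSn big_ord_recl /tcoef !qbinn0; congr (_ + _).
  have E : (penz (0%:Z - a.+1%:Z) = 3 * a + 1 + penz (0%:Z - a%:Z))%N.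
    have := penzS (0%:Z - a.+1%:Z).
    have -> : 0%:Z - a.+1%:Z + 1 = 0%:Z - a%:Z by lia.
    lia.
  have -> : 0%:Z - a%:Z - 1 = 0%:Z - a.+1%:Z by lia.
  by rewrite E (exprD _ (3 * a + 1)%N) /= !addn0 exprS; ring.
apply: eq_bigr => k _; rewrite lift0 !addSn qbinSS_dual ?(leq_ord k) //.
have -> : k.+1%:Z - a.+1%:Z = k%:Z - a%:Z by lia.
have -> : k.+1%:Z - a%:Z - 1 = k%:Z - a%:Z by lia.
have -> : k.+1%:Z - a%:Z = k%:Z - a%:Z + 1 by lia.
have E : (3 * a + 1 + penz (k%:Z - a%:Z + 1) =
          penz (k%:Z - a%:Z) + 3 * k.+1)%N.
  have := penzS (k%:Z - a%:Z); move: (penz _) (penz _) => u v; lia.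
transitivity (w (k%:Z - a%:Z) * ((-1) ^+ (a + k)) *
  (q ^+ penz (k%:Z - a%:Z) * qbin (a + b) k
   + q ^+ (3 * a + 1 + penz (k%:Z - a%:Z + 1)) * qbin (a + b) k.+1)).
  by rewrite E (exprD _ (penz _)) (addnS a) !(exprS (-1)); ring.
by rewrite (addnS a) (exprD _ (3 * a + 1)%N) (exprS (-1)); ring.
Qed.

Lemma tsum_const a b :
  tsum a b (fun=> 1) = qpoch (q ^+ 3) q a * qpoch (q ^+ 3) (q ^+ 2) b.
Proof.
have lin a' b' x : tsum a' b' (fun=> 1 - x * 1) = (1 - x) * tsum a' b' (fun=> 1).
  by rewrite /tsum mulr_sumr; apply: eq_bigr => k _; ring.
elim: a => [|a IHa]; first elim: b => [|b IHb].
- by rewrite /tsum big_ord1 /tcoef qbinn0 !qpoch0 /= !mulr1.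
- by rewrite tsumSr lin IHb [in RHS]qpochSr -!exprM addnC exprD exprM; ring.
- by rewrite tsumSl lin IHa [in RHS]qpochSr -!exprM addnC exprD; ring.
Qed.

Lemma qpoch_split3 a :
  qpoch q q (3 * a) =
  qpoch (q ^+ 3) q a * qpoch (q ^+ 3) (q ^+ 2) a * qpoch (q ^+ 3) (q ^+ 3) a.
Proof.
elim: a => [|a IHa]; first by rewrite muln0 !qpoch0 !mulr1.
have -> : (3 * a.+1 = (3 * a).+3)%N by lia.
rewrite !qpochSr IHa -!exprM -!exprD -!exprS; ring.
Qed.

End TripleProduct.

(** * The Lambert series as a logarithmic derivative *)

Section Lambert.
Context (A : comNzRingType) (q : A) (N : nat).
Context (qN : q ^+ N = 0).

(* The expansion of q^i / (1 - q^i), for i > 0. *)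
Definition geom (i : nat) : A := \sum_(t < N) q ^+ (i * t.+1).

Lemma geomE i : (0 < i)%N -> (1 - q ^+ i) * geom i = q ^+ i.
Proof.
move=> i_gt0; rewrite /geom mulrBl mul1r.
rewrite {1}(@sum_shift _ _ (fun t => q ^+ (i * t.+1))) ?muln1.
  rewrite -addrA mulr_sumr -sumrB big1 ?addr0 // => t _.
  by rewrite -exprD -mulnS subrr.
by rewrite (expq_eq0 qN) // mulnS (leq_trans _ (leq_addl _ _)) // leq_pmull.
Qed.

Definition lambert (a b : nat) : A :=
  \sum_(i < a) geom (3 * i + 1) - \sum_(j < b) geom (3 * j + 2).

(** The Leibniz rule for z d/dz at z = 1: a factor 1 - xz contributes -x/(1-x) and a factor 1 - x/z
    contributes x/(1-x). *)
Lemma tsum_id a b :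
  tsum q a b (fun d => d%:~R) = tsum q a b (fun=> 1) * lambert a b.
Proof.
have linr a' b' x : tsum q a' b' (fun d => d%:~R - x * (d + 1)%:~R) =
    (1 - x) * tsum q a' b' (fun d => d%:~R) - x * tsum q a' b' (fun=> 1).
  rewrite /tsum !mulr_sumr -sumrB; apply: eq_bigr => k _.
  by rewrite rmorphD /=; ring.
have linl a' b' x : tsum q a' b' (fun d => d%:~R - x * (d - 1)%:~R) =
    (1 - x) * tsum q a' b' (fun d => d%:~R) + x * tsum q a' b' (fun=> 1).
  rewrite /tsum !mulr_sumr -big_split; apply: eq_bigr => k _ /=.
  by rewrite rmorphB /=; ring.
have lin a' b' x : tsum q a' b' (fun=> 1 - x * 1) = (1 - x) * tsum q a' b' (fun=> 1).
  by rewrite /tsum mulr_sumr; apply: eq_bigr => k _; ring.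
elim: a => [|a IHa]; first elim: b => [|b IHb].
- by rewrite /tsum /lambert !big_ord1 !big_ord0 !subrr mulr0 mul0r.
- rewrite !tsumSr lin linr IHb /lambert !big_ord0 big_ord_recr /=.
  (* The lone power x is written as (1 - x) times its geometric series, which avoids division. *)
  rewrite -{2}(@geomE (3 * b + 2)) ?addnS //; ring.
- rewrite !tsumSl lin linl IHa /lambert big_ord_recr /=.
  rewrite -{2}(@geomE (3 * a + 1)) ?addnS //; ring.
Qed.

(* Dividing the derivative of the triple product by its value at z = 1. *)
Lemma lambert_ser :
  lambert (2 * N) (2 * N) =
  pser q N * \sum_(M < N) (-1) ^+ M * (q ^+ pen1 M.+1 - q ^+ pen2 M.+1) *+ M.+1.
Proof.
have q3N : (q ^+ 3) ^+ N = 0 by rewrite exprAC qN expr0n.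
have F d : (N <= `|d|)%N -> q ^+ penz d = 0.
  by move=> le_Nd; rewrite (expq_eq0 qN) // (leq_trans le_Nd) ?penz_geq.
transitivity (pser q N * (qpoch (q ^+ 3) (q ^+ 3) (2 * N) *
    tsum q (2 * N) (2 * N) (fun d => d%:~R))).
  rewrite tsum_id tsum_const.
  have := @pser_qpoch _ _ _ qN (3 * (2 * N)) ltac:(lia).
  rewrite qpoch_split3 => E; rewrite -[LHS]mul1r -E; ring.
congr (_ * _); rewrite /tsum mulr_sumr.
transitivity (\sum_(k < 2 * N + (2 * N).+1)
    (k%:Z - (2 * N)%:Z)%:~R * (-1) ^+ k * q ^+ penz (k%:Z - (2 * N)%:Z)).
  rewrite -addnS; apply: eq_bigr => k _; rewrite /tcoef.
  rewrite exprD exprM expr2 mulN1r opprK expr1n mul1r.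
  (* Either the power of q vanishes, or k and 4N - k are both at least N and the binomial is the
     full 1/(q^3;q^3)_oo, which cancels. Taking 2N factors of each kind ensures this. *)
  have [le_Nd|lt_dN] := leqP N `|k%:Z - (2 * N)%:Z|%N.
    by rewrite F ?mulr0 ?mul0r ?mulr0.
  rewrite /qbin; case: leqP => [le_k|]; last by lia.
  rewrite (gauss_pser q3N); try lia.
  rewrite -[RHS]mulr1 -(@pser_qpoch _ _ _ q3N (2 * N)); [ring | lia].
(* The term d = 0 has weight 0; reversing the negative half pairs d = -(M+1) with d = M+1. *)
rewrite big_split_ord /= big_ord_recl /= addn0 subrr !mul0r add0r.
rewrite -(big_mkord xpredT (fun k => (k%:Z - (2 * N)%:Z)%:~R * (-1) ^+ k
  * q ^+ penz (k%:Z - (2 * N)%:Z))) big_nat_rev /= big_mkord.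
rewrite -big_split /=.
transitivity (\sum_(M < N + N)
  (-1) ^+ M * (q ^+ pen1 M.+1 - q ^+ pen2 M.+1) *+ M.+1).
  rewrite [in RHS]addnn -mul2n; apply: eq_bigr => M _; rewrite add0n.
  have ltM := ltn_ord M.
  have -> : (2 * N - M.+1)%N%:Z - (2 * N)%:Z = Negz M by lia.
  have -> : (2 * N + bump 0 M)%N%:Z - (2 * N)%:Z = M.+1%:Z by rewrite /bump; lia.
  have sgn m n : odd m = odd n -> (-1) ^+ m = (-1) ^+ n :> A.
    by move=> e; rewrite -signr_odd e signr_odd.
  rewrite (sgn _ M.+1); last by rewrite oddB // oddM.
  rewrite (sgn (2 * N + bump 0 M)%N M.+1); last by rewrite oddD oddM.
  rewrite NegzE mulrNz -!pmulrn /= -mulr_natr exprS; ring.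
rewrite big_split_ord /= [X in _ + X]big1 ?addr0 // => M _.
by rewrite !(expq_eq0 qN) ?subrr ?mulr0 ?mul0rn // /pen1 /pen2; lia.
Qed.
End Lambert.

(** * Enumeration of partitions *)

(* The weakly decreasing sequences of length [k] with entries at most [b],
   entries 0 included. *)
Fixpoint box (k b : nat) {struct k} : seq (seq nat) :=
  if k is k'.+1 then
    (fix box_row (b : nat) : seq (seq nat) :=
       if b is b'.+1 then map (cons b) (box k' b) ++ box_row b'
       else [:: nseq k 0]) b
  else [:: [::]].
Arguments box : simpl never.

Lemma boxS0 k : box k.+1 0 = [:: nseq k.+1 0%N]. Proof. by []. Qed.

Lemma boxSS k b :
  box k.+1 b.+1 = map (cons b.+1) (box k b.+1) ++ box k.+1 b.
Proof. by []. Qed.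

Lemma sorted_geq_cons x (s : seq nat) :
  sorted geq (x :: s) = all (geq x) s && sorted geq s.
Proof. by apply: path_sortedE => y z t; apply: (fun h k => leq_trans k h). Qed.

Lemma sorted_geq_rcons (s : seq nat) x :
  sorted geq (rcons s x) = all (leq x) s && sorted geq s.
Proof.
elim: s => //= y s IHs; rewrite -/(sorted geq (y :: rcons s x)).
rewrite -/(sorted geq (y :: s)) !sorted_geq_cons IHs all_rcons /=.
by rewrite [RHS]andbACA -!andbA.
Qed.

Lemma mem_box k b s :
  (s \in box k b) = [&& size s == k, sorted geq s & all (geq b) s].
Proof.
elim: k b s => [|k IHk] b s; first by rewrite inE; case: s.
elim: b s => [|b IHb] s.
  rewrite boxS0 inE; apply/eqP/and3P => [->|[/eqP sz _ s0]].
    split; rewrite ?size_nseq ?all_nseq //.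
    by elim: k {IHk} => // k; rewrite [sorted _ (nseq k.+2 _)]/= => ->.
  have /all_pred1P -> : all (pred1 0%N) s; last by rewrite sz.
  by apply: sub_all s0 => x /=; rewrite leqn0.
rewrite boxSS mem_cat IHb; case: s => [|x s].
  by rewrite andFb orbF; apply/mapP => -[].
rewrite sorted_geq_cons /= eqSS.
have [->|ne_x] := eqVneq x b.+1.
  rewrite mem_map; last by move=> u v [].
  rewrite IHk ltnn !andbF orbF leqnn /=.
  by case: (size s == k); case: (sorted _ _); case: (all _ _).
have /negPf -> : x :: s \notin map (cons b.+1) (box k b.+1).
  by apply/mapP => -[t _ [e]]; rewrite e eqxx in ne_x.
have -> : (x <= b.+1)%N = (x <= b)%N by lia.
case: (leqP x b) => [le_xb|_]; last by rewrite !andbF.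
case: (boolP (all (geq x) s)) => [/allP le_s|_]; last by rewrite !andbF.
have -> : all (geq b) s; first by apply/allP => y /le_s /leq_trans; apply.
have -> // : all (geq b.+1) s.
by apply/allP => y /le_s /leq_trans; apply; apply: leqW.
Qed.

Lemma box_uniq k b : uniq (box k b).
Proof.
elim: k b => // k IHk; elim=> // b IHb.
rewrite boxSS cat_uniq IHb map_inj_uniq ?IHk; last by move=> u v [].
rewrite andbT /=; apply/hasPn => s; rewrite mem_box => /and3P[_ _ /allP le_s].
by apply/mapP => -[t _ e]; have := le_s b.+1; rewrite e mem_head /= ltnn => /(_ isT).
Qed.

(** [box] and [gauss] share their recursion: the first entry either equals b+1 or is at most b. *)
Lemma box_ser (A : comNzRingType) (q : A) k b :
  \sum_(s <- box k b) q ^+ sumn s = gauss q k b.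
Proof.
elim: k b => [|k IHk] b; first by rewrite big_seq1.
elim: b => [|b IHb].
  by rewrite boxS0 big_seq1 sumn_nseq mul0n.
rewrite boxSS big_cat big_map IHb gaussSS -IHk mulr_sumr /=; congr (_ + _).
by apply: eq_bigr => s _; rewrite exprD.
Qed.

Lemma geq_head (s : seq nat) b :
  sorted geq s -> all (geq b) s = (head 0 s <= b)%N.
Proof.
case: s => [|x s] //; rewrite sorted_geq_cons => /andP[/allP le_s _] /=.
apply/andb_idr => le_xb; apply/allP => y /le_s /leq_trans; exact.
Qed.

Lemma sorted_geq_add x (s : seq nat) :
  sorted geq (map (addn x) s) = sorted geq s.
Proof. by rewrite sorted_map; apply: eq_sorted => y z /=; rewrite leq_add2l. Qed.

Lemma sumn_add x (s : seq nat) : sumn (map (addn x) s) = (x * size s + sumn s)%N.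
Proof. by elim: s => [|y s IHs] /=; rewrite ?IHs; lia. Qed.

Lemma size_le_sumn (s : seq nat) : all (leq 1) s -> (size s <= sumn s)%N.
Proof. by elim: s => //= x s IHs /andP[x_gt0 /IHs]; lia. Qed.

Lemma mem_le_sumn (s : seq nat) x : x \in s -> (x <= sumn s)%N.
Proof. by elim: s => //= y s IHs; rewrite inE => /predU1P[->|/IHs]; lia. Qed.

(** The least part x cancels in the difference, so the condition only bounds the entries of t by one
    more than their number. *)
Lemma kimberling_add x (t : seq nat) :
  (kimberling (map (addn x) (rcons t 0%N)) <= 0) = (head 0 t <= (size t).+1)%N.
Proof.
rewrite /kimberling map_rcons last_rcons size_rcons size_map addn0.
by case: t => [|y t] /=; rewrite ?headI /=; lia.
Qed.

(** [g] recovers the outer index, so the lists for distinct indices are disjoint. *)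
Lemma uniq_allpairs_tag (S T R : eqType) (f : S -> T -> R) s t (g : R -> S) :
  uniq s -> {in s, forall x, uniq (t x)} ->
  (forall x, injective (f x)) ->
  (forall x y, x \in s -> y \in t x -> g (f x y) = x) ->
  uniq [seq f x y | x <- s, y <- t x].
Proof.
move=> us ut f_inj fK; apply: allpairs_uniq_dep => // p p'.
move=> /allpairsPdep[x [y [xs yt ->]]] /allpairsPdep[x' [y' [xs' yt' ->]]] /= e.
have ex : x = x' by rewrite -(fK x y) // e fK.
by case: x' / ex xs' yt' e => xs' yt' /f_inj ->.
Qed.

(** * Generating functions of partition counts *)

Section Series.
Context (A : comNzRingType) (q : A) (N : nat).
Context (qN : q ^+ N = 0).

Definition nparts (Q : pred (seq nat)) (i : nat) : nat :=
  #|[set t in partitions i | Q (map val t)]|.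

(** Passes from the finite type of bounded sequences to an explicit list; [partitions_onto] ensures
    that no partition is lost. *)
Lemma nparts_count Q (X : seq (seq nat)) i :
  uniq X ->
  (forall s, sumn s = i -> (s \in X) = is_partition i s && Q s) ->
  nparts Q i = count (fun s => sumn s == i) X.
Proof.
move=> uX memX; rewrite /nparts cardE -(size_map (fun t : i.-bseq 'I_i.+1 => map val t)).
rewrite -size_filter; apply: perm_size; apply: uniq_perm.
- rewrite map_inj_uniq ?enum_uniq // => t u /(inj_map val_inj) e.
  exact: val_inj.
- exact: filter_uniq.
move=> s; rewrite mem_filter; apply/mapP/andP => [[t]|[/eqP sum_s]].
  rewrite mem_enum inE => /andP[]; rewrite inE => pt Qt ->.
  have /and3P[_ _ /eqP sum_t] := pt.
  by rewrite sum_t eqxx memX // pt.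
rewrite memX // => /andP[/partitions_onto[t pt <-] Qt].
by exists t; rewrite // mem_enum inE pt.
Qed.

Lemma nparts_ser Q (X : seq (seq nat)) :
  uniq X ->
  (forall s, (sumn s < N)%N -> (s \in X) = is_partition (sumn s) s && Q s) ->
  \sum_(s <- X) q ^+ sumn s = \sum_(i < N) (nparts Q i)%:R * q ^+ i.
Proof.
move=> uX memX.
transitivity (\sum_(s <- X) \sum_(i < N | sumn s == i) q ^+ i).
  apply: eq_bigr => s _; have [lt_sN|le_Ns] := ltnP (sumn s) N.
    by rewrite (big_pred1 (Ordinal lt_sN)).
  rewrite (expq_eq0 qN) // big1 // => i /eqP e.
  by have := ltn_ord i; rewrite -e ltnNge le_Ns.
rewrite (exchange_big_dep xpredT) //=; apply: eq_bigr => i _.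
rewrite (@nparts_count Q X) //; last by move=> s e; rewrite memX e.
by rewrite big_const_seq iter_addr_0 mulr_natl.
Qed.

(** Read [pser] as D_1(N): lowering each of the k parts by 1 gives a sequence in [box k (k + N)], a
    bound that holds for every partition of a number below N. *)
Lemma pser_nparts : pser q N = \sum_(i < N) (npartitions i)%:R * q ^+ i.
Proof.
pose X := [seq map (addn 1) t | k <- iota 0 N, t <- box k (k + N)].
transitivity (\sum_(s <- X) q ^+ sumn s).
  rewrite -(dsum_large qN (leqnn N)) /dsum big_allpairs_dep -[N in iota _ N]subn0.
  rewrite big_mkord; apply: eq_bigr => k _.
  rewrite -box_ser mulr_sumr big_seq [RHS]big_seq; apply: eq_bigr => t.
  by rewrite mem_box => /and3P[/eqP sz _ _]; rewrite sumn_add sz exprD.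
rewrite (@nparts_ser predT).
- by apply: eq_bigr => i _; congr (_%:R * _); apply: eq_card => t; rewrite !inE andbT.
- apply: (@uniq_allpairs_tag _ _ _ _ _ _ size) => [|k _|k|k t].
  + exact: iota_uniq.
  + exact: box_uniq.
  + by apply: inj_map; apply: addnI.
  + by rewrite mem_box size_map => _ /and3P[/eqP].
move=> s lt_sN; rewrite andbT /is_partition eqxx andbT.
apply/allpairsPdep/andP => [[k [t [_ + ->]]]|[sort_s s_gt0]].
  rewrite mem_box sorted_geq_add => /and3P[_ -> _]; split=> //.
  by rewrite all_map; apply/allP.
have e : map (addn 1) (map predn s) = s.
  rewrite -map_comp -[RHS]map_id; apply/eq_in_map => x /(allP s_gt0) /=.
  by rewrite add1n; apply: prednK.
exists (size s), (map predn s); split=> //.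
  by rewrite mem_iota /= add0n (leq_ltn_trans (size_le_sumn s_gt0)).
rewrite mem_box size_map eqxx /= -(sorted_geq_add 1) e sort_s /=.
rewrite all_map; apply/allP => x /mem_le_sumn /=; lia.
Qed.

(** Here u+1 is the least part, k+1 the number of parts, and t lists the other parts lowered by u+1.
    The empty sequence has index 0 by the default values but no least part, so it is excluded. *)
Lemma kimberling_nparts :
  \sum_(u < N) q ^+ u.+1 * dsum q N u.+1 1 =
  \sum_(i < N) (nparts (fun s => (s != [::]) && (kimberling s <= 0)) i)%:R * q ^+ i.
Proof.
pose f u t := map (addn u.+1) (rcons t 0%N).
pose X := [seq f p.1 t | p <- [seq (u, k) | u <- iota 0 N, k <- iota 0 N],
                         t <- box p.2 p.2.+1].
transitivity (\sum_(s <- X) q ^+ sumn s).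
  rewrite !big_allpairs_dep -[N in iota _ N]subn0 big_mkord.
  apply: eq_bigr => u _; rewrite mulr_sumr big_mkord; apply: eq_bigr => k _ /=.
  rewrite addn1 -box_ser !mulr_sumr big_seq [RHS]big_seq; apply: eq_bigr => t.
  rewrite mem_box => /and3P[/eqP sz _ _].
  rewrite sumn_add size_rcons sz sumn_rcons addn0 mulnS !exprD; ring.
apply: nparts_ser.
- apply: (@uniq_allpairs_tag _ _ _ _ _ _
    (fun s => ((last 0%N s).-1, (size s).-1))) => [|p _|p|[u k] t].
  + by rewrite allpairs_uniq ?iota_uniq // => -[? ?] [? ?].
  + exact: box_uniq.
  + by apply: inj_comp (@rcons_injl _ 0%N); apply/inj_map/addnI.
  + rewrite mem_box /f map_rcons last_rcons size_rcons size_map addn0.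
    by move=> _ /and3P[/eqP-> _ _].
move=> s lt_sN; rewrite /is_partition eqxx andbT.
apply/allpairsPdep/idP => [[[u k] [t [_ + ->]]]|].
  rewrite mem_box /f sorted_geq_add sorted_geq_rcons kimberling_add /=.
  move=> /and3P[/eqP sz sort_t]; rewrite geq_head // sz => ->.
  rewrite sort_t !andbT map_rcons all_rcons /= all_map.
  rewrite -size_eq0 size_rcons /= andbT; apply/andP; split; exact/allP.
case/lastP: s lt_sN => [|s x] lt_sN; first by rewrite andbF.
rewrite sorted_geq_rcons all_rcons => /and3P[/andP[/andP[le_xs sort_s] /andP[x_gt0 s_gt0]]] _ K.
pose t := map (subn^~ x) s.
have e : map (addn x) (rcons t 0%N) = rcons s x.
  rewrite map_rcons addn0 -map_comp; congr (rcons _ x).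
  rewrite -[RHS]map_id; apply/eq_in_map => y /(allP le_xs) /=.
  exact: subnKC.
have := K; rewrite -{1}e kimberling_add size_map => le_h.
exists (x.-1, size s), t; rewrite /f /= prednK // e; split=> //.
  have lt_s : (size s < N)%N.
    have := @size_le_sumn (rcons s x); rewrite all_rcons x_gt0 size_rcons.
    by move=> /(_ s_gt0); lia.
  have lt_x : (x.-1 < N)%N.
    have := @mem_le_sumn (rcons s x) x; rewrite mem_rcons mem_head => /(_ isT).
    by lia.
  by apply/allpairsP; exists (x.-1, size s); rewrite !mem_iota /= !add0n.
have sort_t : sorted geq t.
  have : sorted geq (map (addn x) (rcons t 0%N)).
    by rewrite e sorted_geq_rcons le_xs.
  by rewrite sorted_geq_add sorted_geq_rcons => /andP[].
by rewrite mem_box size_map eqxx sort_t geq_head.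
Qed.

End Series.

(** * Coefficient extraction *)

(* [divisors 0] is [:: 1], hence the separate treatment of [n = 0]. *)
Lemma sum_dvdn_d3 j n N : (0 < j < 3)%N -> (n < N)%N ->
  (\sum_(i < N) ((0 < n) && (3 * i + j %| n)) = (0 < n) * d3 j n)%N.
Proof.
move=> j_bnd lt_nN; have [->|n_gt0] := posnP n.
  by rewrite big1.
rewrite mul1n -(big_mkord xpredT (fun i => nat_of_bool (3 * i + j %| n)%N)) /d3.
transitivity (count (fun i => 3 * i + j %| n)%N (iota 0 N)).
  rewrite -sum1_count [RHS]big_mkcond -[N in iota _ N]subn0.
  by apply: eq_bigr => i _; case: (_ %| _)%N.
rewrite -!size_filter -(size_map (fun i => 3 * i + j)%N); apply: perm_size.
apply: uniq_perm; rewrite ?filter_uniq ?divisors_uniq //.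
  by rewrite map_inj_uniq ?filter_uniq ?iota_uniq // => a b; lia.
move=> d; rewrite mem_filter -dvdn_divisors //; apply/mapP/andP.
  move=> [i + ->]; rewrite mem_filter => /andP[-> _]; split=> //.
  by rewrite mulnC modnMDl.
move=> [/eqP dj dn]; exists (d %/ 3)%N; last by lia.
have e : (3 * (d %/ 3) + j = d)%N by lia.
rewrite mem_filter e dn mem_iota /= add0n.
by have := dvdn_leq n_gt0 dn; lia.
Qed.

Section FinalSeries.
Context (A : comNzRingType) (q : A) (N : nat).
Context (qN : q ^+ N = 0).

Lemma geom_dvdn k : (0 < k)%N ->
  geom q N k = \sum_(n < N) ((0 < n) && (k %| n))%N%:R * q ^+ n.
Proof.
move=> k_gt0; transitivity (\sum_(t < N) \sum_(n < N | (k * t.+1)%N == n) q ^+ n).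
  apply: eq_bigr => t _; have [lt_tN|le_Nt] := ltnP (k * t.+1)%N N.
    by rewrite (big_pred1 (Ordinal lt_tN)).
  rewrite (expq_eq0 qN) // big1 // => n /eqP e.
  by have := ltn_ord n; rewrite -e ltnNge le_Nt.
rewrite (exchange_big_dep xpredT) //=; apply: eq_bigr => n _.
have [/andP[n_gt0 /dvdnP[m e]]|nk] := boolP ((0 < n) && (k %| n))%N.
  have m_gt0 : (0 < m)%N by lia.
  have lt_mN : (m.-1 < N)%N.
    have := ltn_ord n; have := leq_pmulr m k_gt0; lia.
  rewrite mul1r (big_pred1 (Ordinal lt_mN)) // => t.
  rewrite -[RHS]val_eqE /= e mulnC eqn_pmul2r //; lia.
rewrite mul0r big_pred0 // => t; apply: contraNF nk => /eqP <-.
by rewrite muln_gt0 k_gt0 dvdn_mulr.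
Qed.

Lemma sum_geom_d3 j : (0 < j < 3)%N ->
  \sum_(i < 2 * N) geom q N (3 * i + j) = \sum_(n < N) ((0 < n) * d3 j n)%N%:R * q ^+ n.
Proof.
move=> j_bnd; transitivity (\sum_(i < 2 * N) \sum_(n < N)
    ((0 < n) && (3 * i + j %| n))%N%:R * q ^+ n).
  by apply: eq_bigr => i _; rewrite geom_dvdn //; lia.
rewrite exchange_big; apply: eq_bigr => n _ /=.
rewrite -mulr_suml -natr_sum (sum_dvdn_d3 j_bnd) //.
by have := ltn_ord n; lia.
Qed.

(** Each factor q raises all degrees by one; the vacated lowest coefficient is [p] at a negative
    integer, hence 0. *)
Lemma pser_shift e :
  pser q N * q ^+ e = \sum_(i < N) (p (i%:Z - e%:Z))%:R * q ^+ i.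
Proof.
elim: e => [|e IHe].
  rewrite mulr1 (pser_nparts qN); apply: eq_bigr => i _.
  by rewrite subr0.
rewrite exprSr mulrA IHe mulr_suml.
rewrite (@sum_shift _ _ (fun i => (p (i%:Z - e.+1%:Z))%:R * q ^+ i)).
  rewrite [X in p X](_ : _ = Negz e) ?mul0r ?add0r; last by lia.
  apply: eq_bigr => i _; rewrite -mulrA -exprSr.
  by congr ((p _)%:R * _); lia.
by rewrite qN mulr0.
Qed.

(** The Kimberling series has q^(P_m) + q^(P_(-m)) where the Lambert series has the difference, so
    they differ by twice the q^(P_(-m)) part. *)
Lemma nparts_kimberling_ser :
  \sum_(i < N)
     (nparts (fun s => (s != [::]) && (kimberling s <= 0)) i)%:Z%:~R * q ^+ i =
  \sum_(i < N)
     (((0 < i) * d3 1 i)%N%:Z - ((0 < i) * d3 2 i)%N%:Z + 2 * \sum_(M < N)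
       M.+1%:Z * (-1) ^+ M * (p (i%:Z - (pen2 M.+1)%:Z))%:Z)%:~R * q ^+ i.
Proof.
rewrite -(kimberling_nparts qN) (kimberling_ser qN).
transitivity (lambert q N (2 * N) (2 * N) +
  2 * \sum_(M < N) (M.+1%:Z * (-1) ^+ M)%:~R * (pser q N * q ^+ pen2 M.+1)).
  rewrite (lambert_ser qN) !mulr_sumr -big_split; apply: eq_bigr => M _ /=.
  rewrite rmorphM rmorphXn rmorphN1 /= -mulr_natl; ring.
rewrite /lambert !sum_geom_d3 // -sumrB.
under [X in 2 * X]eq_bigr => M _ do rewrite pser_shift mulr_sumr.
rewrite exchange_big mulr_sumr -big_split; apply: eq_bigr => i _ /=.
rewrite rmorphD rmorphB rmorphM rmorph_sum /= !(mulrDl _ _ (q ^+ i)) mulNr; congr (_ + _).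
rewrite -mulrA. congr (_ * _); rewrite mulr_suml; apply: eq_bigr => M _.
by rewrite [in RHS]rmorphM /= mulrA.
Qed.

End FinalSeries.

(** Take for q the class of X in Z[X]/(X^N), where polynomials of degree below N are their own
    representatives. *)
Lemma trunc_ser_inj (N : nat) (c c' : nat -> int) :
  (forall (A : comNzRingType) (q : A), q ^+ N = 0 ->
     \sum_(i < N) (c i)%:~R * q ^+ i = \sum_(i < N) (c' i)%:~R * q ^+ i) ->
  forall i, (i < N)%N -> c i = c' i.
Proof.
move=> E i lt_iN; have N_gt0 : (0 < N)%N by apply: leq_trans lt_iN.
pose h : {poly int} := 'X^N.
(* The quotient is taken by [mk_monic h], which is h itself because X^N is monic and N > 0. *)
have mkh : mk_monic h = h.
  by rewrite /mk_monic /h size_polyXn ltnS N_gt0 monicXn.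
have qXE (b : nat -> int) : in_qpoly h (\poly_(i < N) b i) =
    \sum_(i < N) (b i)%:~R * (in_qpoly h 'X) ^+ i.
  rewrite poly_def rmorph_sum /=; apply: eq_bigr => k _.
  by rewrite -mul_polyC rmorphM rmorphXn /= -[b k in LHS]intz !rmorph_int.
have small b : in_qpoly h (\poly_(i < N) b i) = \poly_(i < N) b i :> {poly int}.
  by rewrite in_qpoly_small // mkh /h size_polyXn ltnS size_poly.
have qN : (in_qpoly h 'X) ^+ N = 0.
  rewrite -rmorphXn; apply: val_inj => /=.
  by rewrite mkh Pdiv.RingMonic.rmodpp // monicXn.
have /(congr1 val) /= := E _ _ qN.
rewrite -!qXE => /(congr1 (fun P : {poly int} => P`_i)).
by rewrite !small !coef_poly lt_iN.
Qed.

(** * The range of summation and the conclusion *)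

Lemma sum_ord_widen (A : nmodType) (F : nat -> A) m n :
  (forall k, (m <= k)%N -> F k = 0) -> (forall k, (n <= k)%N -> F k = 0) ->
  \sum_(k < m) F k = \sum_(k < n) F k.
Proof.
wlog le_mn : m n / (m <= n)%N => [th Fm Fn|Fm _].
  by case/orP: (leq_total m n) => le_mn; [|symmetry]; apply: th.
rewrite -(subnKC le_mn) big_split_ord /= [X in _ + X]big1 ?addr0 // => k _.
by rewrite Fm ?leq_addr.
Qed.

Lemma P_opp m : P (- m%:Z) = (pen2 m)%:Z.
Proof.
have e : - m%:Z * (3 * - m%:Z - 1) = (pen2 m)%:Z * 2.
  by rewrite /pen2; elim: m => // m; rewrite bin2S; nia.
by rewrite /P e mulzK.
Qed.

Lemma p_neg (n m : nat) : (n < m)%N -> p (n%:Z - m%:Z) = 0%N.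
Proof. by move=> lt_nm; have -> : n%:Z - m%:Z = Negz (m - n).-1 by lia. Qed.

(** The real number under the floor is the nonnegative root of x(3x+1)/2 = n, and 1 + 24 P_(-m) =
    (6m+1)^2; beyond it P_(-m) exceeds n. *)
Lemma floor_pen2 (R : realType) (n m : nat) :
  (`|Num.floor ((-1 + Num.sqrt (1 + 24 * n%:R)) / 6 : R)|%N <= m)%N ->
  (n < pen2 m.+1)%N.
Proof.
set x := (X in Num.floor X) => le_xm.
have s_ge0 : 0 <= 1 + 24 * n%:R :> R by rewrite addr_ge0 ?mulr_ge0 ?ler0n.
have lt_x : x < m.+1%:R.
  have : (Num.floor x < m.+1%:Z)%R by lia.
  by rewrite floor_lt_int.
have lt_s : Num.sqrt (1 + 24 * n%:R) < 6 * m.+1%:R + 1 :> R.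
  by move: lt_x; rewrite /x ltr_pdivrMr //; lra.
have : 1 + 24 * n%:R < (6 * m.+1%:R + 1) ^+ 2 :> R.
  by rewrite -(sqr_sqrtr s_ge0) ltrXn2r // ?sqrtr_ge0 // (le_trans (sqrtr_ge0 _) (ltW lt_s)).
rewrite -!natrM -!(natrD _ _ 1) -natrX -(natrD _ 1) ltr_nat.
have e : (2 * pen2 m.+1 = m.+1 * (3 * m.+1 + 1))%N.
  by rewrite /pen2; elim: m.+1 => // k; rewrite bin2S; nia.
by move: e; nia.
Qed.
Theorem theorem3p2 (R : realType) (n : nat) (n_gt1 : (1 < n)%N) :
  ((K_le n)%:Z = (d3 1 n)%:Z - (d3 2 n)%:Z +
     2 * \sum_(1 <= m < (`|Num.floor ((-1 + Num.sqrt (1 + 24 * n%:R)) / 6 : R)|%N).+1)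
           m%:Z * (-1) ^+ (m - 1) * (p (n%:Z - P (- m%:Z)))%:Z)
  /\ ((K_le n)%:Z = (d3 1 n)%:Z - (d3 2 n)%:Z %[mod 2])%Z.
Proof.
set S := \sum_(1 <= m < _) _.
have K_leE : (K_le n)%:Z = (d3 1 n)%:Z - (d3 2 n)%:Z + 2 * S.
  pose K i := (nparts (fun s => (s != [::]) && (kimberling s <= 0)) i)%:Z.
  pose c i := ((0 < i) * d3 1 i)%N%:Z - ((0 < i) * d3 2 i)%N%:Z +
    2 * \sum_(M < n.+1) M.+1%:Z * (-1) ^+ M * (p (i%:Z - (pen2 M.+1)%:Z))%:Z.
  have : K n = c n.
    apply: (@trunc_ser_inj n.+1) (ltnSn n) => A q.
    exact: nparts_kimberling_ser.
  rewrite /K /c.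
  (* As n > 1, no partition of n is empty. *)
  have -> : nparts (fun s => (s != [::]) && (kimberling s <= 0)) n = K_le n.
    apply: eq_card => t; rewrite !inE; case: (boolP (is_partition _ _)) => //=.
    case: (map _ _) => //= /and3P[_ _ /eqP e].
    by rewrite -e in n_gt1.
  rewrite (ltnW n_gt1) !mul1n => ->; congr (_ + 2 * _).
  rewrite /S big_add1 big_mkord /=.
  (* Both cutoffs lie past the last nonzero term, since P_(-m) > n makes [p] vanish. *)
  rewrite (@sum_ord_widen _ (fun M => M.+1%:Z * (-1) ^+ M *
      (p (n%:Z - (pen2 M.+1)%:Z))%:Z) _
      `|Num.floor ((-1 + Num.sqrt (1 + 24 * n%:R)) / 6 : R)|%N).
  - by apply: eq_bigr => M _; rewrite P_opp subn1.
  - by move=> M lt_nM; rewrite p_neg ?mulr0 // /pen2; lia.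
  - by move=> M /floor_pen2 lt_n; rewrite p_neg ?mulr0.
by split=> //; rewrite K_leE addrC mulrC modzMDl.
Qed.
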